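(* Let $n\ge 1$, let $A\subseteq\omega$, let $\varphi=\varphi^{(n)}$ be a Gödel numbering of $\mathcal P^{(n)}$, and let $\psi$ be a $\varphi$-standard numbering of $\mathcal S^{(n)}_A$. Then the following two conditions hold: (QGN I) The extended graph of the $(n+1)$-ary function $(i,\vec x)\mapsto\psi_i(\vec x)$ is the range of some function in $\mathcal R^{(1)}$. (QGN II) For every $k\in\mathcal R^{(2)}$ there exists $v\in\mathcal R^{(1)}$ such that for all $i\in\omega$ and all $r\in\mathcal S^{(n)}_A$: if $t\mapsto k(i,t)$ enumerates (i.e. has as its range) the extended graph of $r$, then $r=\psi_{v(i)}$.
   Context: $\omega$ is the set of natural numbers. For $n\ge 1$, $\mathcal P^{(n)}$ and $\mathcal R^{(n)}$ are the sets of partial computable, respectively total computable, functions from $\omega^n$ to $\omega$. $\langle\cdot,\cdot\rangle:\omega^2\to\omega$ is a computable bijection with $\langle x,y\rangle\ge x,y$, extended to tuples by $\langle x\rangle=x$, $\langle x_1,\dots,x_{n+1}\rangle=\langle x_1,\langle x_2,\dots,x_{n+1}\rangle\rangle$. For $A\subseteq\omega$, $\mathrm{Anf}^{(n)}_A$ is the set of partial functions from $\omega^n$ to $\omega$ whose domain is either empty or of the form $\{0,\dots,a-1\}^n$ with $a\in A$, and $\mathcal S^{(n)}_A=\mathcal R^{(n)}\cup\mathrm{Anf}^{(n)}_A$. The extended graph of a partial function $q$ from $\omega^n$ to $\omega$ is the set $\{\langle\langle\vec y\rangle,0\rangle:\vec y\in\omega^n\}\cup\{\langle\langle\vec x\rangle,q(\vec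 x)+1\rangle:\vec x\in\mathrm{dom}(q)\}$. A numbering of a set $X$ is a surjection $\omega\to X$, with value at $i$ written with subscript $i$. A Gödel numbering of $\mathcal P^{(n)}$ is a numbering whose universal function $(i,\vec x)\mapsto\varphi_i(\vec x)$ is partial computable and such that for every partial computable $g$ of arity $n+1$ there is $s\in\mathcal R^{(1)}$ with $\varphi_{s(i)}(\vec x)=g(i,\vec x)$ for all $i,\vec x$. A $\varphi$-standard numbering of a set $X\subseteq\mathcal P^{(n)}$ is a numbering $\psi$ of $X$ of the form $\psi_i=\varphi_{d(i)}$ for some $d\in\mathcal R^{(1)}$ such that, for all $i$, $\varphi_i\in X$ implies $\varphi_{d(i)}=\varphi_i$. *)

(* Defs.v *)
From mathcomp Require Import all_boot.
From mathcomp Require Import boolp classical_sets.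

Set Implicit Arguments.
Unset Strict Implicit.
Unset Printing Implicit Defensive.

Local Open Scope classical_set_scope.

(* [None] is divergence: the base logic is classical (boolp), so every
   single-valued relation is the graph of some [pfun n], and two partial
   functions are equal iff they agree pointwise. *)
Definition pfun (n : nat) : Type := n.-tuple nat -> option nat.

Definition dom (n : nat) (f : pfun n) : set (n.-tuple nat) :=
  [set x | exists y, f x = Some y].

Definition pcomp (n m : nat) (g : pfun m) (h : 'I_m -> pfun n) (f : pfun n) :
    Prop :=
  forall x y, f x = Some y <->
    exists2 z : m.-tuple nat,
      (forall j, h j x = Some (tnth z j)) & g z = Some y.

Fixpoint piter (n : nat) (g : pfun n) (h : pfun n.+2) (k : nat)
    (x : n.-tuple nat) : option nat :=
  if k is k'.+1 then
    obind (fun r => h [tuple of k' :: r :: x]) (piter g h k' x)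
  else g x.

Definition prec (n : nat) (g : pfun n) (h : pfun n.+2) : pfun n.+1 :=
  fun z => piter g h (thead z) (behead_tuple z).

Definition pmin (n : nat) (g : pfun n.+1) (f : pfun n) : Prop :=
  forall x y, f x = Some y <->
    g [tuple of y :: x] = Some 0 /\
    forall z, z < y -> exists w, g [tuple of z :: x] = Some w.+1.

(* Kleene's mu-recursive functions. *)
Inductive partial_computable : forall n : nat, pfun n -> Prop :=
| pc_zero n : @partial_computable n (fun _ => Some 0)
| pc_succ : @partial_computable 1 (fun x => Some (thead x).+1)
| pc_proj n (j : 'I_n) : @partial_computable n (fun x => Some (tnth x j))
| pc_comp n m (g : pfun m) (h : 'I_m -> pfun n) (f : pfun n) :
    partial_computable g -> (forall j, partial_computable (h j)) ->
    pcomp g h f -> partial_computable f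
| pc_rec n (g : pfun n) (h : pfun n.+2) :
    partial_computable g -> partial_computable h ->
    partial_computable (prec g h)
| pc_min n (g : pfun n.+1) (f : pfun n) :
    partial_computable g -> pmin g f -> partial_computable f.

Definition Pfuns (n : nat) : set (pfun n) := [set f | partial_computable f].

Definition Rfuns (n : nat) : set (pfun n) :=
  [set f | partial_computable f /\ dom f = setT].

(* Membership in R^(1) and R^(2) for curried total functions. *)
Definition computable1 (f : nat -> nat) : Prop :=
  Rfuns (fun x : 1.-tuple nat => Some (f (thead x))).

Definition computable2 (f : nat -> nat -> nat) : Prop :=
  Rfuns (fun x : 2.-tuple nat =>
    Some (f (tnth x ord0) (tnth x ord_max))).

Definition is_pairing (pair : nat -> nat -> nat) : Prop :=
  [/\ computable2 pair,
      bijective (fun p : nat * nat => pair p.1 p.2) &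
      forall x y, x <= pair x y /\ y <= pair x y].

Fixpoint code_cons (pair : nat -> nat -> nat) (x : nat) (s : seq nat) : nat :=
  if s is y :: s' then pair x (code_cons pair y s') else x.

(* The value 0 at the empty tuple is a dummy: arities are positive in use. *)
Definition tuple_code (pair : nat -> nat -> nat) (n : nat) (x : n.-tuple nat) :
    nat :=
  if val x is y :: s then code_cons pair y s else 0.

Definition extended_graph (pair : nat -> nat -> nat) (n : nat) (q : pfun n) :
    set nat :=
  [set z | (exists y : n.-tuple nat, z = pair (tuple_code pair y) 0) \/
           (exists (x : n.-tuple nat) (m : nat),
              q x = Some m /\ z = pair (tuple_code pair x) m.+1)].

Definition Anf (n : nat) (A : set nat) : set (pfun n) :=
  [set f | dom f = set0 \/
           exists2 a, A a & dom f = [set x | forall j, tnth x j < a]].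

Definition Sfuns (n : nat) (A : set nat) : set (pfun n) :=
  @Rfuns n `|` @Anf n A.

Definition is_numbering (T : Type) (X : set T) (nu : nat -> T) : Prop :=
  range nu = X.

Definition universal (n : nat) (nu : nat -> pfun n) : pfun n.+1 :=
  fun z => nu (thead z) (behead_tuple z).

Definition is_goedel_numbering (n : nat) (phi : nat -> pfun n) : Prop :=
  [/\ is_numbering (@Pfuns n) phi,
      partial_computable (universal phi) &
      forall g : pfun n.+1, partial_computable g ->
        exists2 s : nat -> nat, computable1 s &
          forall i x, phi (s i) x = g [tuple of i :: x]].

Definition is_standard_numbering (n : nat) (phi : nat -> pfun n)
    (X : set (pfun n)) (psi : nat -> pfun n) : Prop :=
  [/\ X `<=` @Pfuns n, is_numbering X psi &
      exists d : nat -> nat,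
        [/\ computable1 d, (forall i, psi i = phi (d i)) &
            forall i, X (phi i) -> phi (d i) = phi i]].

(* Main.v *)
(* A partial computable f is the limit of total computable stages F t, so
   listing pair <x> 0 and pair <x> (F t x) over all coded (t, x) enumerates the
   extended graph of f; for (QGN I) apply this to f (i, x) = phi (d i) x.
   For (QGN II), searching k i for a pair whose first component is the code of x
   and whose second component is nonzero recovers r x from any enumeration k i
   of the extended graph of r. The s-m-n property gives s with phi (s i) = r,
   and then r in S_A forces psi (s i) = phi (d (s i)) = phi (s i) = r. *)
Require Import Defs.
From mathcomp Require Import all_boot.
From mathcomp Require Import boolp classical_sets.

Local Open Scope classical_set_scope.

(** * Closure properties of total computable functions *)

Definition total_computable {n : nat} (f : n.-tuple nat -> nat) : Prop :=
  partial_computable (fun x => Some (f x)).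

Definition vector_computable {n m : nat} (h : n.-tuple nat -> m.-tuple nat) :
    Prop :=
  forall j, total_computable (fun x => tnth (h x) j).

Lemma total_Rfuns n (f : n.-tuple nat -> nat) :
  total_computable f -> @Rfuns n (fun x => Some (f x)).
Proof.
by move=> cf; split=> //; apply/seteqP; split=> x // _; exists (f x).
Qed.

Lemma thead_cons n (a : nat) (x : n.-tuple nat) : thead [tuple of a :: x] = a.
Proof. by []. Qed.

Lemma behead_cons n (a : nat) (x : n.-tuple nat) :
  behead_tuple [tuple of a :: x] = x.
Proof. exact: val_inj. Qed.

Lemma cons_thead_behead n (z : n.+1.-tuple nat) :
  [tuple of thead z :: behead_tuple z] = z.
Proof. by rewrite [RHS]tuple_eta; apply: val_inj. Qed.

Definition tuple_consE := (thead_cons, behead_cons, cons_thead_behead).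

(** With total inner functions the relational [pcomp] reduces to plain substitution; most later
    computability proofs go through this form. *)
Lemma pc_vector {n m} {g : pfun m} {h : n.-tuple nat -> m.-tuple nat} :
  partial_computable g -> vector_computable h ->
  partial_computable (fun x => g (h x)).
Proof.
move=> cg ch; apply: (pc_comp cg ch) => x y; split=> [gy | [z hz <-]].
  by exists (h x).
by congr g; apply: eq_from_tnth => j; case: (hz j).
Qed.

Lemma tc_vector {n m} {f : m.-tuple nat -> nat}
    {h : n.-tuple nat -> m.-tuple nat} :
  total_computable f -> vector_computable h ->
  total_computable (fun x => f (h x)).
Proof. exact: pc_vector. Qed.

Lemma vc_id {n} : vector_computable (fun x : n.-tuple nat => x).
Proof. by move=> j; apply: pc_proj. Qed.

Lemma vc_behead {n m} {h : n.-tuple nat -> m.+1.-tuple nat} :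
  vector_computable h -> vector_computable (fun x => behead_tuple (h x)).
Proof.
move=> ch j; have := ch (lift ord0 j); congr (partial_computable _).
apply/funext => x; rewrite tnth_behead; congr (Some (tnth _ _)).
by apply: val_inj; rewrite /= inordK // ltnS.
Qed.

Lemma tc_thead {n m} {h : n.-tuple nat -> m.+1.-tuple nat} :
  vector_computable h -> total_computable (fun x => thead (h x)).
Proof. by move=> ch; apply: ch. Qed.

Lemma tc_arg0 {n} : total_computable (fun x : n.+1.-tuple nat => thead x).
Proof. exact: tc_thead vc_id. Qed.

Lemma tc_arg1 {n} :
  total_computable (fun x : n.+2.-tuple nat => thead (behead_tuple x)).
Proof. exact: tc_thead (vc_behead vc_id). Qed.

Lemma tc_arg2 {n} : total_computable
  (fun x : n.+3.-tuple nat => thead (behead_tuple (behead_tuple x))).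
Proof. exact: tc_thead (vc_behead (vc_behead vc_id)). Qed.

Lemma vc_cons {n m} {a : n.-tuple nat -> nat}
    {h : n.-tuple nat -> m.-tuple nat} :
  total_computable a -> vector_computable h ->
  vector_computable (fun x => [tuple of a x :: h x]).
Proof.
move=> ca ch j; case: (unliftP ord0 j) => [i|] ->; last exact: ca.
have := ch i; congr (partial_computable _).
by apply/funext => x; rewrite tnthS.
Qed.

Lemma vc_nil {n} :
  vector_computable (fun _ : n.-tuple nat => [tuple] : 0.-tuple nat).
Proof. by move=> []. Qed.

Lemma tc_succ {n} {a : n.-tuple nat -> nat} :
  total_computable a -> total_computable (fun x => (a x).+1).
Proof.
move=> ca.
exact: (tc_vector (f := fun x => (thead x).+1) pc_succ (vc_cons ca vc_nil)).
Qed.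

Lemma tc_const {n} c : total_computable (fun _ : n.-tuple nat => c).
Proof. by elim: c => [|c IHc]; [apply: pc_zero | apply: (tc_succ IHc)]. Qed.

Lemma tc_unary {n} {f : nat -> nat} {a : n.-tuple nat -> nat} :
  computable1 f -> total_computable a -> total_computable (fun x => f (a x)).
Proof.
move=> [cf _] ca.
exact: (tc_vector cf (vc_cons ca vc_nil)).
Qed.

Lemma tc_binary {n} {f : nat -> nat -> nat} {a b : n.-tuple nat -> nat} :
  computable2 f -> total_computable a -> total_computable b ->
  total_computable (fun x => f (a x) (b x)).
Proof.
move=> [cf _] ca cb.
exact: (tc_vector cf (vc_cons ca (vc_cons cb vc_nil))).
Qed.

Fixpoint recn (b : nat) (s : nat -> nat -> nat) (k : nat) : nat :=
  if k is k'.+1 then s k' (recn b s k') else b.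

Lemma tc_rec {n} {b : n.-tuple nat -> nat}
    {s : nat -> nat -> n.-tuple nat -> nat}
    {k : n.-tuple nat -> nat} :
  total_computable b ->
  total_computable (fun z : n.+2.-tuple nat =>
    s (thead z) (thead (behead_tuple z)) (behead_tuple (behead_tuple z))) ->
  total_computable k ->
  total_computable (fun x => recn (b x) (fun j r => s j r x) (k x)).
Proof.
move=> cb cs ck.
have := pc_vector (pc_rec cb cs) (vc_cons ck vc_id).
congr (partial_computable _); apply/funext => x.
rewrite /prec !tuple_consE; elim: (k x) => //= j ->.
by rewrite /= !tuple_consE; congr (Some (s _ _ _)); apply: val_inj.
Qed.

Lemma tc_pred {n} {a : n.-tuple nat -> nat} :
  total_computable a -> total_computable (fun x => (a x).-1).
Proof.
move=> ca; have := tc_rec (s := fun j _ _ => j) (tc_const 0) tc_arg0 ca.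
by congr (total_computable _); apply/funext => x; case: (a x).
Qed.

Lemma tc_add {n} {a b : n.-tuple nat -> nat} :
  total_computable a -> total_computable b ->
  total_computable (fun x => a x + b x).
Proof.
move=> ca cb.
have := tc_rec (s := fun _ r _ => r.+1) ca (tc_succ tc_arg1) cb.
congr (total_computable _); apply/funext => x.
by elim: (b x) => [|k /= ->]; rewrite ?addn0 ?addnS.
Qed.

Lemma tc_sub {n} {a b : n.-tuple nat -> nat} :
  total_computable a -> total_computable b ->
  total_computable (fun x => a x - b x).
Proof.
move=> ca cb.
have := tc_rec (s := fun _ r _ => r.-1) ca (tc_pred tc_arg1) cb.
congr (total_computable _); apply/funext => x.
by elim: (b x) => [|k /= ->]; rewrite ?subn0 ?subnS.
Qed.

Lemma tc_if_eq {n} {c d a b : n.-tuple nat -> nat} :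
  total_computable c -> total_computable d ->
  total_computable a -> total_computable b ->
  total_computable (fun x => if c x == d x then a x else b x).
Proof.
move=> cc cd ca cb.
(* The recursion runs for |c - d| rounds, written with truncated subtraction: no round leaves [a],
   and any positive number of rounds yields [b]. *)
have := tc_rec (s := fun _ _ x => b x) ca
  (tc_vector cb (vc_behead (vc_behead vc_id)))
  (tc_add (tc_sub cc cd) (tc_sub cd cc)).
congr (total_computable _); apply/funext => x.
rewrite eqn_leq -!subn_eq0 -addn_eq0.
by case: (_ + _).
Qed.

Lemma tc_sum {n} m {h : 'I_m -> n.-tuple nat -> nat} :
  (forall j, total_computable (h j)) ->
  total_computable (fun x => \sum_(j < m) h j x).
Proof.
elim: m h => [|m IHm] h ch.
  by under eq_fun do rewrite big_ord0; apply: tc_const.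
under eq_fun do rewrite big_ord_recl.
by apply: tc_add => //; apply: IHm => j; apply: ch.
Qed.

(** * Unbounded search *)

Lemma pc_search {n} {p : nat -> n.-tuple nat -> nat} :
  total_computable (fun z : n.+1.-tuple nat => p (thead z) (behead_tuple z)) ->
  exists f : pfun n, [/\ partial_computable f,
    forall x y, f x = Some y -> p y x = 0 /\ forall z, z < y -> p z x <> 0 &
    forall x z, p z x = 0 -> exists y, f x = Some y].
Proof.
move=> cp.
(* The least zero is chosen classically; computability follows afterwards, because this function
   satisfies the [pmin] specification. *)
pose f x :=
  if pselect (exists z, p z x == 0) is left e then Some (ex_minn e) else None.
have fP x y : f x = Some y <-> p y x = 0 /\ forall z, z < y -> p z x <> 0.
  rewrite /f; case: pselect => [e | ne]; last first.
    by split=> // -[py _]; case: ne; exists y; rewrite py.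
  case: ex_minnP => m /eqP pm minm; split=> [[<-] | [py miny]].
    by split=> // z zm /eqP /minm; rewrite leqNgt zm.
  congr Some; apply/eqP; rewrite eqn_leq minm ?py //=.
  by rewrite leqNgt; apply/negP => /miny.
exists f; split=> [|x y /fP //|x z pz].
- apply: (pc_min cp) => x y; rewrite !tuple_consE; split.
    move=> /fP[-> miny]; split=> // z /miny.
    by rewrite !tuple_consE; case: (p z x) => // w _; exists w.
  move=> [[py] miny]; apply/fP; split=> // z /miny [w].
  by rewrite !tuple_consE => -[->].
- rewrite /f; case: pselect => [e | []]; last by exists z; rewrite pz.
  by eexists.
Qed.

Lemma tc_search {n} {p : nat -> n.-tuple nat -> nat} :
  total_computable (fun z : n.+1.-tuple nat => p (thead z) (behead_tuple z)) ->
  (forall x, exists z, p z x = 0) ->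
  exists2 m : n.-tuple nat -> nat, total_computable m &
    forall x, p (m x) x = 0 /\ forall z, z < m x -> p z x <> 0.
Proof.
move=> cp ex; have [f [cf fP fex]] := pc_search cp.
have fE x : f x = Some (odflt 0 (f x)).
  by have [z /fex[y ->]] := ex x.
exists (fun x => odflt 0 (f x)) => [|x]; last exact/fP/fE.
by move: cf; congr (partial_computable _); apply/funext.
Qed.

Lemma pc_omap {n} {f : pfun n} {q : nat -> n.-tuple nat -> nat} :
  partial_computable f ->
  total_computable (fun z : n.+1.-tuple nat => q (thead z) (behead_tuple z)) ->
  partial_computable (fun x => omap (q^~ x) (f x)).
Proof.
move=> cf cq.
(* The inner functions for composing with [q]: [f] in position 0, then the projections, so the
   composite diverges exactly where [f] does. *)
pose h (j : 'I_n.+1) : pfun n :=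
  if unlift ord0 j is Some i then fun x => Some (tnth x i) else f.
apply: (@pc_comp _ _ _ h _ cq) => [j | x y].
  by rewrite /h; case: unlift => // i; apply: pc_proj.
split=> [|[z hz [<-]]].
  case fx: (f x) => [t|] //= -[<-].
  exists [tuple of t :: x]; last by rewrite !tuple_consE.
  by move=> j; rewrite /h; case: unliftP => [i|] -> //; rewrite tnthS.
have := hz ord0; rewrite /h unlift_none => -> /=; congr (Some (q _ _)).
apply: eq_from_tnth => i; have := hz (lift ord0 i); rewrite /h liftK => -[->].
by rewrite -[z]cons_thead_behead tnthS tuple_consE.
Qed.

(** * Computable decoding of pairs and tuples *)

(** Both components are found by search. Since the second component of [m] is at most [m], the inner
    search over it can be cut off and made total, so that the outer search can use it. *)
Lemma computable_unpair {pair : nat -> nat -> nat} : is_pairing pair ->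
  exists l r : nat -> nat, [/\ computable1 l, computable1 r,
    forall m, pair (l m) (r m) = m &
    forall a b, l (pair a b) = a /\ r (pair a b) = b].
Proof.
move=> [cpair [unpair pairK unpairK] le_pair].
have {le_pair} pair_surj m : exists a b, pair a b = m /\ b <= m.
  exists (unpair m).1, (unpair m).2; have e := unpairK m; split=> //=.
  by rewrite -{2}e; case: (le_pair (unpair m).1 (unpair m).2).
(* On input (a, m) the search looks for [b] with [pair a b = m], and gives up at [b = m.+1], just
   beyond every possible second component. *)
pose q b (x : 2.-tuple nat) :=
  if pair (thead x) b == thead (behead_tuple x) then 0
  else if b == (thead (behead_tuple x)).+1 then 0 else 1.
have [|x|s cs sP] := @tc_search 2 q.
- by apply: (tc_if_eq (tc_binary cpair tc_arg1 tc_arg0) tc_arg2 (tc_const 0) _);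
     apply: (tc_if_eq tc_arg0 (tc_succ tc_arg2) (tc_const 0) (tc_const 1)).
- exists (thead (behead_tuple x)).+1; rewrite /q eqxx; by case: ifP.
pose p a (x : 1.-tuple nat) :=
  if pair a (s [tuple of a :: x]) == thead x then 0 else 1.
have cvz : total_computable (fun z : 2.-tuple nat =>
    s [tuple of thead z :: behead_tuple z]) :=
  tc_vector cs (vc_cons tc_arg0 (vc_behead vc_id)).
have [|x|l cl lP] := @tc_search 1 p.
- exact: tc_if_eq
    (tc_binary cpair tc_arg0 cvz) tc_arg1 (tc_const 0) (tc_const 1).
- have [a [b [eab leb]]] := pair_surj (thead x); exists a; rewrite /p.
  have [+ smin] := sP [tuple of a :: x]; rewrite /q !tuple_consE.
  case: eqP => // _; case: eqP => // sE _.
  (* Otherwise the inner search would have stopped at [m.+1], although the smaller [b] already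
     satisfies [pair a b = m]. *)
  by case: (smin b); rewrite ?sE ?ltnS // /q !tuple_consE eab eqxx.
pose l1 m := l [tuple m]; pose r1 m := s [tuple l1 m; m].
have pairE m : pair (l1 m) (r1 m) = m.
  have [+ _] := lP [tuple m]; rewrite /p thead_cons.
  have -> : [tuple of l [tuple m] :: [tuple m]] = [tuple l1 m; m].
    exact: val_inj.
  by case: eqP.
have tuple1E (x : 1.-tuple nat) : [tuple thead x] = x.
  by rewrite [RHS]tuple_eta; apply: val_inj; case: x => [[|? []]].
have cl1 : computable1 l1.
  apply: total_Rfuns; move: cl; congr (partial_computable _).
  by apply/funext => x; rewrite /l1 tuple1E.
have cr1 : computable1 r1.
  apply: total_Rfuns; apply: (tc_vector cs).
  exact: (vc_cons (tc_unary cl1 tc_arg0) (vc_cons tc_arg0 vc_nil)).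
exists l1, r1; split=> // a b.
by case: (can_inj pairK
  (pairE (pair a b) : _ (l1 (pair a b), r1 (pair a b)) = _ (a, b))).
Qed.

Lemma tc_tuple_code {pair n m} {h : m.-tuple nat -> n.+1.-tuple nat} :
  is_pairing pair -> vector_computable h ->
  total_computable (fun x => tuple_code pair (h x)).
Proof.
move=> [cpair _ _]; elim: n h => [|n IHn] h ch.
  have := tc_thead ch; congr (total_computable _); apply/funext => x.
  by case: (h x) => -[|? []].
have := tc_binary cpair (tc_thead ch) (IHn _ (vc_behead ch)).
congr (total_computable _); apply/funext => x.
by case: (h x) => -[|? []].
Qed.

(** Components are peeled off one at a time with the projections of [pair]. The arity is a successor
    because [tuple_code] has only a dummy value at the empty tuple. *)
Lemma computable_tuple_decode {pair n} : is_pairing pair ->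
  exists D : nat -> n.+1.-tuple nat,
  [/\ vector_computable (fun x : 1.-tuple nat => D (thead x)),
      cancel D (tuple_code pair (n := n.+1)) &
      cancel (tuple_code pair (n := n.+1)) D].
Proof.
move=> Hp; have [l [r [cl cr pairE unpairE]]] := computable_unpair Hp.
elim: n => [|n [D [cD DK KD]]].
  exists (fun m => [tuple m]); split=> [|//|x].
    exact: (vc_cons tc_arg0 vc_nil).
  by apply: val_inj; case: x => [[|? []]].
exists (fun m => [tuple of l m :: D (r m)]); split=> [|m|x].
- apply: (vc_cons (tc_unary cl tc_arg0)) => j.
  exact: (tc_vector (cD j) (vc_cons (tc_unary cr tc_arg0) vc_nil)).
- rewrite -[RHS]pairE -[r m in RHS]DK.
  by case: (D _) => -[|? []].
- have -> : tuple_code pair x =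
      pair (thead x) (tuple_code pair (behead_tuple x)).
    by case: x => -[|? []].
  have [-> ->] := unpairE (thead x) (tuple_code pair (behead_tuple x)).
  by rewrite KD cons_thead_behead.
Qed.

(** * Stagewise approximation of partial computable functions *)

(* [F t x] is [0] while stage [t] has not found a value and [y.+1] once it has
   found [y]. Stages need not be monotone, only eventually constant on
   [dom f]. *)
Definition approximates {n} (F : nat -> n.-tuple nat -> nat) (f : pfun n) :
    Prop :=
  [/\ total_computable
        (fun z : n.+1.-tuple nat => F (thead z) (behead_tuple z)),
      forall t x y, F t x = y.+1 -> f x = Some y &
      forall x y, f x = Some y -> exists t0, forall t, t0 <= t -> F t x = y.+1].

Lemma tc_approx {n m} {F : nat -> n.-tuple nat -> nat} {t h} :
  total_computable (fun z : n.+1.-tuple nat => F (thead z) (behead_tuple z)) ->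
  total_computable t -> vector_computable h ->
  total_computable (fun x : m.-tuple nat => F (t x) (h x)).
Proof.
move=> cF ct ch; have := tc_vector cF (vc_cons ct ch).
by congr (total_computable _); apply/funext => x; rewrite !tuple_consE.
Qed.

Lemma approximable_total {n} {f : n.-tuple nat -> nat} : total_computable f ->
  exists F, approximates F (fun x => Some (f x)).
Proof.
move=> cf; exists (fun _ x => (f x).+1); split=> [|t x y [->] //|x y [->]].
  exact: (tc_succ (tc_vector cf (vc_behead vc_id))).
by exists 0.
Qed.

(** The maximum of finitely many thresholds serves them all. It is used to wait until several
    computations have settled at once. *)
Lemma uniform_threshold {m} {P : 'I_m -> nat -> Prop} :
  (forall j, exists t0, forall t, t0 <= t -> P j t) ->
  exists t0, forall t, t0 <= t -> forall j, P j t.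
Proof.
move=> /choice[t0 t0P]; exists (\max_j t0 j) => t le_t j.
by apply: t0P; apply: leq_trans le_t; apply: leq_bigmax.
Qed.

(** Stage [t] evaluates every argument at stage [t] and, if all are found, the outer function at the
    same stage. *)
Lemma approximable_comp {n m} {g : pfun m} {h : 'I_m -> pfun n} {f : pfun n} :
  Defs.pcomp g h f -> (exists G, approximates G g) ->
  (forall j, exists H, approximates H (h j)) -> exists F, approximates F f.
Proof.
move=> fE [G [cG sG eG]] /choice[H HP].
(* The number of arguments not yet found at stage [t]. *)
pose undef t x := \sum_(j < m) (if H j t x == 0 then 1 else 0).
(* The predecessor undoes the shift of [approximates]; for an argument not yet found it gives a junk
   0, which the test on [undef] discards. *)
pose args t x := [tuple (H j t x).-1 | j < m].
have cH j : total_computable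
  (fun z : n.+1.-tuple nat => H j (thead z) (behead_tuple z)) by case: (HP j).
exists (fun t x => if undef t x == 0 then G t (args t x) else 0); split.
- apply: (tc_if_eq _ (tc_const 0) _ (tc_const 0)).
    apply: tc_sum => j.
    exact: (tc_if_eq (cH j) (tc_const 0) (tc_const 1) (tc_const 0)).
  apply: (tc_approx cG tc_arg0 _) => j.
  have := tc_pred (cH j); congr (total_computable _).
  by apply/funext => x; rewrite tnth_mktuple.
- move=> t x y; case: eqP => // /eqP.
  rewrite /undef sum_nat_eq0 => /forallP /= allH /sG gy; apply/fE; exists (args t x) => // j.
  rewrite tnth_mktuple; have [_ sH _] := HP j; apply: (sH t).
  by have := allH j; case: (H j t x).
- move=> x y /fE[z hz gz].
  have [t1 t1P] :
      exists t0, forall t, t0 <= t -> forall j, H j t x = (tnth z j).+1.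
    by apply: uniform_threshold => j; have [_ _ eH] := HP j; apply: eH.
  have [t2 t2P] := eG _ _ gz.
  exists (maxn t1 t2) => t; rewrite geq_max => /andP[/t1P Ht /t2P Gt].
  have -> : undef t x = 0 by rewrite /undef big1 // => j _; rewrite Ht.
  rewrite -Gt eqxx; congr (G t _); apply: eq_from_tnth => j.
  by rewrite tnth_mktuple Ht.
Qed.

(** One stage [t] is used in all rounds of the recursion, and a 0 from an unfinished round
    propagates to the end. *)
Lemma approximable_rec {n} {g : pfun n} {h : pfun n.+2} :
  (exists G, approximates G g) -> (exists H, approximates H h) ->
  exists F, approximates F (prec g h).
Proof.
move=> [G [cG sG eG]] [H [cH sH eH]].
pose step t (x : n.-tuple nat) j r :=
  if r == 0 then 0 else H t [tuple of j :: r.-1 :: x].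
exists (fun t (z : n.+1.-tuple nat) =>
  recn (G t (behead_tuple z)) (step t (behead_tuple z)) (thead z)).
split.
(* The arguments are ordered as (stage, recursion count, parameters). *)
- apply: (tc_rec (s := fun j r (z : n.+2.-tuple nat) =>
    step (thead z) (behead_tuple (behead_tuple z)) j r)).
  + exact: tc_approx cG tc_arg0 (vc_behead (vc_behead vc_id)).
  + have cr := @tc_arg1 n.+2.
    have cz := vc_behead (vc_behead (@vc_id n.+4)).
    apply: (tc_if_eq cr (tc_const 0) (tc_const 0) _).
    apply: (tc_approx cH (tc_thead cz) _).
    exact: (vc_cons tc_arg0 (vc_cons (tc_pred cr) (vc_behead (vc_behead cz)))).
  + exact: tc_arg1.
- move=> t z; rewrite /prec; elim: (thead z) => [|k IHk] y /=; first exact: sG.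
  rewrite {1}/step; case: (recn _ _ k) IHk => // r IHk /=.
  by rewrite (IHk r) //; apply: sH.
(* The threshold is built by induction on the count: the maximum of the one for the earlier rounds
   and the one for the last round. *)
- move=> z; rewrite /prec; elim: (thead z) => [|k IHk] y /=; first exact: eG.
  case pk: (piter g h k _) => [r|] //= hr.
  have [t1 t1P] := IHk _ pk; have [t2 t2P] := eH _ _ hr.
  exists (maxn t1 t2) => t; rewrite geq_max => /andP[/t1P -> /t2P <-].
  by rewrite /step.
Qed.

(** Stage [t] looks up to [t] for the first [y] where [G t] is 0 (nothing found) or 1 (value 0
    found), and accepts only in the second case. All smaller arguments then have positive values
    already found. *)
Lemma approximable_min {n} {g : pfun n.+1} {f : pfun n} :
  pmin g f -> (exists G, approximates G g) -> exists F, approximates F f.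
Proof.
move=> fE [G [cG sG eG]].
(* The bound [y = t] makes the search at stage [t] total; a stage value [0]
   stops it too, since it may stem from a divergence of [g]. *)
pose p y (w : n.+1.-tuple nat) :=
  if y == thead w then 0
  else (G (thead w) [tuple of y :: behead_tuple w]).-1.
have [|w|s cs sP] := @tc_search n.+1 p.
- have cw := vc_behead (@vc_id n.+2).
  apply: (tc_if_eq tc_arg0 (tc_thead cw) (tc_const 0) (tc_pred _)).
  exact: tc_approx cG (tc_thead cw) (vc_cons tc_arg0 (vc_behead cw)).
- by exists (thead w); rewrite /p eqxx.
pose S t (x : n.-tuple nat) := s [tuple of t :: x].
(* The predecessor in [p] identifies the stage values 0 and 1, hence the bound [<= 1]. *)
have SP t x : (S t x = t \/ G t [tuple of S t x :: x] <= 1) /\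
    forall z, z < S t x -> 1 < G t [tuple of z :: x].
  have [] := sP [tuple of t :: x]; rewrite /p -/(S t x) !tuple_consE => p0 pmin.
  split.
    case: eqP p0 => [-> _|_ p0]; [by left | right].
    by case: (G _ _) p0 => [|[]].
  move=> z /pmin; case: eqP => // _.
  by case: (G _ _) => [|[]].
exists (fun t x => if G t [tuple of S t x :: x] == 1 then (S t x).+1 else 0).
split.
- have cS : total_computable
      (fun z : n.+1.-tuple nat => S (thead z) (behead_tuple z)).
    exact: tc_vector cs (vc_cons tc_arg0 (vc_behead vc_id)).
  apply: (tc_if_eq _ (tc_const 1) (tc_succ cS) (tc_const 0)).
  exact: tc_approx cG tc_arg0 (vc_cons cS (vc_behead vc_id)).
- move=> t x y; case: eqP => // G1 [<-]; have [_ Smin] := SP t x.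
  apply/fE; split; first exact: sG G1.
  move=> z /Smin; case Gz: (G _ _) => [|[|w]] // _.
  by exists w; apply: sG Gz.
- move=> x y /fE[gy gz].
  have [t1 t1P] := eG _ _ gy.
  have [t2 t2P] : exists t0, forall t, t0 <= t ->
      forall z : 'I_y, 1 < G t [tuple of val z :: x].
    apply: uniform_threshold => z; have [w /eG[t0 t0P]] := gz _ (ltn_ord z).
    by exists t0 => t /t0P ->.
  (* The term [y.+1] forces [y < t], so the cut-off at [t] cannot stop the search before [y]. *)
  exists (maxn y.+1 (maxn t1 t2)) => t.
  rewrite !geq_max => /and3P[lt_yt /t1P Gy /t2P Gz].
  have [S0 Smin] := SP t x.
  suff -> : S t x = y by rewrite Gy.
  apply/eqP; rewrite eqn_leq; apply/andP; split; rewrite leqNgt; apply/negP.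
    by move=> /Smin; rewrite Gy.
  move=> lt_Sy; have := Gz (Ordinal lt_Sy); rewrite ltnNge /=.
  case: S0 => [St|->] //.
  by move: lt_Sy; rewrite St ltnNge ltnW.
Qed.

Lemma approximable {n} {f : pfun n} :
  partial_computable f -> exists F, approximates F f.
Proof.
elim=> {n f} [n||n j|n m g h f _ IHg _ IHh fE|n g h _ IHg _ IHh|n g f _ IHg fE].
- exact: approximable_total (tc_const 0).
- exact: approximable_total (tc_succ tc_arg0).
- exact: approximable_total (pc_proj j).
- exact: approximable_comp fE IHg IHh.
- exact: approximable_rec IHg IHh.
- exact: approximable_min fE IHg.
Qed.

(** * Passing between partial functions and enumerations of extended graphs *)

Lemma extended_graph_enumerable {pair n} {q : pfun n.+1} :
  is_pairing pair -> partial_computable q ->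
  exists2 e, computable1 e & range e = extended_graph pair q.
Proof.
move=> Hp /approximable[F [cF sF eF]].
have [l [r [cl cr pairE unpairE]]] := computable_unpair Hp.
have [D [cD DK KD]] := @computable_tuple_decode pair n Hp.
(* Stages are shifted by one to reserve stage 0 for the pair with second component 0: [F] itself may
   be nonzero at every stage. *)
pose val t x := if t == 0 then 0 else F t.-1 x.
exists (fun m => pair (r m) (val (l m) (D (r m)))).
  apply: total_Rfuns; have [cpair _ _] := Hp.
  apply: (tc_binary cpair (tc_unary cr tc_arg0)).
  apply: (tc_if_eq (tc_unary cl tc_arg0) (tc_const 0) (tc_const 0) _).
  apply: (tc_approx cF (tc_pred (tc_unary cl tc_arg0)) _) => j.
  exact: (tc_vector (cD j) (vc_cons (tc_unary cr tc_arg0) vc_nil)).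
apply/seteqP; split=> [_ [m _ <-] | w].
  case vE: (val _ _) => [|y].
    by left; exists (D (r m)); rewrite DK.
  right; exists (D (r m)), y; rewrite DK; split=> //.
  by move: vE; rewrite /val; case: eqP => // _ /sF.
case=> [[x ->] | [x [y [/eF[t tP] ->]]]].
  exists (pair 0 (tuple_code pair x)) => //.
  by have [-> ->] := unpairE 0 (tuple_code pair x).
exists (pair t.+1 (tuple_code pair x)) => //.
by have [-> ->] := unpairE t.+1 (tuple_code pair x); rewrite KD /val /= tP.
Qed.

(** The function [g] is built from [k] alone with [i] as an argument, which is the uniformity that
    the s-m-n property requires. *)
Lemma function_of_extended_graph {pair n} {k : nat -> nat -> nat} :
  is_pairing pair -> computable2 k ->
  exists2 g : pfun n.+2, partial_computable g &
    forall i (q : pfun n.+1), range (k i) = extended_graph pair q ->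
      forall x : n.+1.-tuple nat, g [tuple of i :: x] = q x.
Proof.
move=> Hp ck; have [l [r [cl cr pairE unpairE]]] := computable_unpair Hp.
have [D [_ _ KD]] := @computable_tuple_decode pair n Hp.
(* Entries with second component 0 occur for every tuple and carry no value, so they are skipped. *)
pose p t (z : n.+2.-tuple nat) :=
  if r (k (thead z) t) == 0 then 1
  else if l (k (thead z) t) == tuple_code pair (behead_tuple z) then 0 else 1.
have cz := vc_behead (@vc_id n.+3).
have ckt : total_computable (fun w : n.+3.-tuple nat =>
  k (thead (behead_tuple w)) (thead w)) := tc_binary ck (tc_thead cz) tc_arg0.
have [|f [cf fP fex]] := @pc_search n.+2 p.
  apply: (tc_if_eq (tc_unary cr ckt) (tc_const 0) (tc_const 1) _).
  apply: (tc_if_eq (tc_unary cl ckt) _ (tc_const 0) (tc_const 1)).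
  exact: tc_tuple_code Hp (vc_behead cz).
exists (fun z => omap (fun t => (r (k (thead z) t)).-1) (f z)).
  apply: (pc_omap (q := fun t z => (r (k (thead z) t)).-1)) => //.
  exact: tc_pred (tc_unary cr ckt).
move=> i q kE x; rewrite thead_cons.
case fx: (f _) => [t|] /=.
  have [+ _] := fP _ _ fx; rewrite /p !tuple_consE.
  have : range (k i) (k i t) by exists t.
  rewrite kE => -[[x' ->] | [x' [y [qx' ->]]]].
    by have [_ ->] := unpairE (tuple_code pair x') 0.
  have [-> ->] := unpairE (tuple_code pair x') y.+1.
  (* Injectivity of [tuple_code] identifies the tuple of the entry found with [x], so its value is
     [q x]. *)
  by case: eqP => // _; case: eqP => // /(can_inj KD) <-.
(* Here the search diverges; a value of [q x] would put an entry into the enumeration that stops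
   it. *)
case qx: (q x) => [y|] //.
have : extended_graph pair q (pair (tuple_code pair x) y.+1).
  by right; exists x, y.
rewrite -kE => -[t _ kt].
have [] := fex [tuple of i :: x] t; last by rewrite fx.
rewrite /p !tuple_consE kt.
by have [-> ->] := unpairE (tuple_code pair x) y.+1; rewrite eqxx.
Qed.

Theorem theorem2p1 (pair : nat -> nat -> nat) (n : nat) (A : set nat)
    (phi psi : nat -> pfun n) :
  is_pairing pair ->
  1 <= n ->
  is_goedel_numbering phi ->
  is_standard_numbering phi (@Sfuns n A) psi ->
  (exists2 e : nat -> nat, computable1 e &
     range e = extended_graph pair (universal psi)) /\
  (forall k : nat -> nat -> nat, computable2 k ->
     exists2 v : nat -> nat, computable1 v &
       forall (i : nat) (r : pfun n), @Sfuns n A r ->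
         range (k i) = extended_graph pair r -> r = psi (v i)).
Proof.
case: n phi psi => // n phi psi Hp _ [_ cphi smn] [_ _ [d [cd psiE dE]]]; split.
  apply: (extended_graph_enumerable Hp).
  have := pc_vector cphi (vc_cons (tc_unary cd tc_arg0) (vc_behead vc_id)).
  congr (partial_computable _); apply/funext => z.
  by rewrite /universal !tuple_consE psiE.
move=> k ck; have [g cg gP] := @function_of_extended_graph pair n k Hp ck.
(* The witness is [s] itself and not its composite with [d], because [psi] already applies [d]. *)
have [s cs sP] := smn g cg; exists s => // i r Sr kE.
have phiE : phi (s i) = r by apply/funext => x; rewrite sP (gP i r).
by rewrite psiE dE phiE.
Qed.
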